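(* Let $r>s\ge1$ be integers and let $G=\overline{\langle a_1,\dots,a_r\rangle}\subset W$ be the closed subgroup topologically generated by the elements $a_1,\dots,a_r\in W$ determined by $a_1=\sigma$, $a_{s+1}=(a_s,a_r)$, and $a_i=(a_{i-1},1)$ for $i\ne1,s+1$. Then the Hausdorff dimension of $G$ exists and is $$\begin{cases}0 & \text{if } s=1 \text{ and } r=2,\\ 1-3\cdot2^{-r} & \text{if } s=1 \text{ and } r\ge3,\\ 1-5\cdot2^{-4} & \text{if } s=2 \text{ and } r=3,\\ 1-2^{1-r} & \text{if } s\ge2 \text{ and } r\ge4.\end{cases}$$
   Context: $T$ is the infinite rooted binary tree whose vertices are the finite words over $\{0,1\}$, with root the empty word, each word $t$ being joined by an edge to $t0$ and $t1$. $T_n\subset T$ is the finite subtree of words of length $\le n$. $W:=\operatorname{Aut}(T)$ is a profinite group as the inverse limit of the finite groups $W_n:=\operatorname{Aut}(T_n)$, and $|W_n|=2^{2^n-1}$. For $u,v\in W$, $(u,v)\in W$ denotes the automorphism $0t\mapsto 0\,u(t)$, $1t\mapsto 1\,v(t)$ for all words $t$; $\sigma\in W$ is the automorphism of order $2$ with $0t\mapsto 1t$ and $1t\mapsto 0t$. Thus $W=(W\times W)\rtimes\langle\sigma\rangle$. The recursion relations for $a_1,\dots,a_r$ have a unique solution in $W$. For a closed subgroup $G\subset W$ with image $G_n$ in $W_n$, the Hausdorff dimension of $G$ is $\lim_{n\to\infty}\frac{\log_2|G_n|}{\log_2|W_n|}=\lim_{n\to\infty}\frac{\log_2|G_n|}{2^n-1}$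 if this limit exists. *)

(* Defs.v *)
From HB Require Import structures.
From mathcomp Require Import all_boot all_order all_algebra all_fingroup.
From mathcomp Require Import all_classical all_reals all_analysis.

Set Implicit Arguments.
Unset Strict Implicit.
Unset Printing Implicit Defensive.

Import Order.TTheory GRing.Theory Num.Theory.
Import numFieldNormedType.Exports.

Local Open Scope classical_set_scope.
Local Open Scope ring_scope.

(* Vertices of T; the letters 0 and 1 are [false] and [true], and the first
   letter of a word is the head of the sequence. *)
Notation word := (seq bool).

Definition child (x y : word) : bool := [exists b : bool, y == rcons x b].

Definition adj (x y : word) : bool := child x y || child y x.

Definition is_tree_aut (f : word -> word) : Prop :=
  [/\ bijective f, f [::] = [::] & forall x y, adj (f x) (f y) = adj x y].

Lemma childE x y : child x y = (y == rcons x false) || (y == rcons x true).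
Proof.
apply/existsP/orP => [[[] ?]|[?|?]]; by [right | left | exists false | exists true].
Qed.

Lemma child_cons b c x y : child (b :: x) (c :: y) = (c == b) && child x y.
Proof. by rewrite !childE /= !eqseq_cons andb_orr. Qed.

Lemma child_nil0 x : child x [::] = false.
Proof. by rewrite childE; case: x. Qed.

Lemma child_nil_cons c y : child [::] (c :: y) = (y == [::]).
Proof. by rewrite childE /= !eqseq_cons; case: c; rewrite /= ?orbF. Qed.

Lemma size_child x y : child x y -> size y = (size x).+1.
Proof. by case/existsP=> b /eqP ->; rewrite size_rcons. Qed.

Lemma child_inj x y z : child x z -> child y z -> x = y.
Proof. by move=> /existsP[b /eqP ->] /existsP[c /eqP] /rcons_inj[]. Qed.

Lemma adj_cons b c x y : adj (b :: x) (c :: y) = (b == c) && adj x y.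
Proof. by rewrite /adj !child_cons andb_orr (eq_sym c). Qed.

Lemma adj_nil_cons c y : adj [::] (c :: y) = (y == [::]).
Proof. by rewrite /adj child_nil_cons child_nil0 orbF. Qed.

Lemma adj_cons_nil c y : adj (c :: y) [::] = (y == [::]).
Proof. by rewrite /adj orbC child_nil_cons child_nil0 orbF. Qed.

Lemma tree_aut_child f x y : is_tree_aut f -> child x y -> child (f x) (f y).
Proof.
move=> [/bij_inj finj f0 fadj]; elim/last_ind: x y => [|x c IHx] y xy.
  have := fadj [::] y; rewrite {2}/adj xy f0 /= /adj.
  by rewrite child_nil0 orbF => ->.
have := fadj (rcons x c) y; rewrite {2}/adj xy /= => /orP[//|yx].
have xxc : child x (rcons x c) by apply/existsP; exists c.
have /finj yE := child_inj yx (IHx _ xxc).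
by move/size_child: xy; rewrite yE size_rcons => /eqP; rewrite -addn2 -[X in X == _]addn0 eqn_add2l.
Qed.

Lemma size_tree_aut f x : is_tree_aut f -> size (f x) = size x.
Proof.
move=> af; elim/last_ind: x => [|x c IHx]; first by case: af => _ ->.
have xxc : child x (rcons x c) by apply/existsP; exists c.
by rewrite (size_child (tree_aut_child af xxc)) IHx size_rcons.
Qed.

Lemma is_tree_aut_id : is_tree_aut id.
Proof. by split=> //; exists id. Qed.

Lemma is_tree_aut_comp f g :
  is_tree_aut f -> is_tree_aut g -> is_tree_aut (g \o f).
Proof.
move=> [bf f0 fadj] [bg g0 gadj]; split; first exact: bij_comp.
  by rewrite /= f0.
by move=> x y /=; rewrite gadj fadj.
Qed.

Lemma is_tree_aut_inv f : is_tree_aut f ->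
  exists g, [/\ is_tree_aut g, cancel f g & cancel g f].
Proof.
move=> [[g fK gK] f0 fadj]; exists g; split=> //; split; first by exists f.
  by rewrite -f0 fK.
by move=> x y; rewrite -fadj !gK.
Qed.

Record W := MkW { Wfun :> word -> word; WfunP : `[< is_tree_aut Wfun >] }.

HB.instance Definition _ := [isSub for Wfun].
HB.instance Definition _ := [Choice of W by <:].

Lemma W_aut (g : W) : is_tree_aut g.
Proof. exact/asboolP/(WfunP g). Qed.

Definition mkW (f : word -> word) (fP : is_tree_aut f) : W := MkW (asboolT fP).

Lemma WP (g h : W) : g =1 h -> g = h.
Proof. by move=> gh; apply/val_inj/funext. Qed.

(* The product follows MathComp's convention for permutations,
   (g * h) t = h (g t), so that restriction to T_n is a homomorphism into
   {perm _}; subgroups do not depend on this choice. *)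
Definition W_one : W := mkW is_tree_aut_id.
Definition W_mul (g h : W) : W := mkW (is_tree_aut_comp (W_aut g) (W_aut h)).
Definition W_inv_spec (g : W) := cid (is_tree_aut_inv (W_aut g)).
Definition W_inv (g : W) : W := mkW (let: And3 P _ _ := svalP (W_inv_spec g) in P).

Lemma W_mulA : associative W_mul. Proof. by move=> f g h; apply: WP. Qed.
Lemma W_mul1 : left_id W_one W_mul. Proof. by move=> g; apply: WP. Qed.
Lemma W_mulr1 : right_id W_one W_mul. Proof. by move=> g; apply: WP. Qed.
Lemma W_mulV : left_inverse W_one W_inv W_mul.
Proof.
by move=> g; apply: WP => t /=; case: (svalP (W_inv_spec g)) => _ _; apply.
Qed.
Lemma W_mulVr : right_inverse W_one W_inv W_mul.
Proof.
by move=> g; apply: WP => t /=; case: (svalP (W_inv_spec g)) => _ + _; apply.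
Qed.

HB.instance Definition _ :=
  isGroup.Build W W_mulA W_mul1 W_mulr1 W_mulV W_mulVr.

Definition sigma_fun (t : word) : word :=
  if t is b :: t' then ~~ b :: t' else [::].

Lemma is_tree_aut_sigma : is_tree_aut sigma_fun.
Proof.
split=> //; first by exists sigma_fun; case=> [|[]].
move=> [|b x] [|c y]; rewrite /= ?adj_nil_cons ?adj_cons_nil // !adj_cons.
by case: b c => [] [].
Qed.

Definition sigma : W := mkW is_tree_aut_sigma.

Definition pair_fun (u v : word -> word) (t : word) : word :=
  if t is b :: t' then b :: (if b then v t' else u t') else [::].

Lemma is_tree_aut_pair (u v : W) : is_tree_aut (pair_fun u v).
Proof.
have nilE (g : W) x : (g x == [::]) = (x == [::]).
  by rewrite -!size_eq0 size_tree_aut //; exact: W_aut.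
split=> //.
  have [[u' uK u'K] _ _] := W_aut u; have [[v' vK v'K] _ _] := W_aut v.
  by exists (pair_fun u' v'); case=> [|[] t] //=; rewrite ?uK ?vK ?u'K ?v'K.
have [_ _ uA] := W_aut u; have [_ _ vA] := W_aut v.
move=> [|b x] [|c y] //=; rewrite ?adj_nil_cons ?adj_cons_nil ?adj_cons.
- by case: c; rewrite nilE.
- by case: b; rewrite nilE.
- by case: b c => [] [] //=; rewrite ?uA ?vA.
Qed.

Definition Wpair (u v : W) : W := mkW (is_tree_aut_pair u v).

(* Automorphism group of T_n; [n.-bseq bool] is the type of words of length at
   most n. *)
Definition Wn (n : nat) : {set {perm n.-bseq bool}} :=
  [set p : {perm n.-bseq bool} | (p [bseq] == [bseq]) &&
    [forall x, forall y, adj (p x) (p y) == adj x y]]%SET.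

Lemma restr_subproof n (g : W) (x : n.-bseq bool) : (size (g x) <= n)%N.
Proof. by rewrite size_tree_aut ?size_bseq //; exact: W_aut. Qed.

Definition restr_fun n (g : W) (x : n.-bseq bool) : n.-bseq bool :=
  Bseq (restr_subproof g x).

Lemma restr_inj n (g : W) : injective (@restr_fun n g).
Proof.
move=> x y [] gxy; apply/val_inj; move: gxy.
by have [/bij_inj ginj _ _] := W_aut g; exact: ginj.
Qed.

Definition restr n (g : W) : {perm n.-bseq bool} := perm (@restr_inj n g).

Lemma restr_Wn n (g : W) : restr n g \in Wn n.
Proof.
have [_ g0 gA] := W_aut g; rewrite inE; apply/andP; split.
  by apply/eqP/val_inj; rewrite permE /= g0.
by apply/forallP => x; apply/forallP => y; rewrite !permE /= gA.
Qed.

(* Profinite topology: the subspace topology of the product of the finite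
   discrete groups W_n, restricted along g |-> (g|T_n)_n. *)
Definition restr_all (g : W) :
  prod_topology (fun n => discrete_topology {perm n.-bseq bool}) :=
  fun n => restr n g.

HB.instance Definition _ := Topological.copy W (initial_topology restr_all).

Definition subgroup (H : set W) : Prop :=
  H 1%g /\ (forall g h, H g -> H h -> H (g * h^-1)%g).

Definition topgen (S : set W) : set W := closure (smallest subgroup S).

Definition Gn (G : set W) (n : nat) : {set {perm n.-bseq bool}} :=
  [set p in restr n @` G]%SET.

Definition log2 {R : realType} (x : R) : R := ln x / ln 2.

Definition has_Hausdorff_dim {R : realType} (G : set W) (d : R) : Prop :=
  log2 #|Gn G n|%:R / log2 #|Wn n|%:R @[n --> \oo] --> d.

(* Main.v *)
(** Write [G_n] for the image of [G] in [Aut(T_n)], [N_n] for the normal closure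
in [G_n] of the [a_j] with [j <> s, r], and [m] for the order of [a_s a_r] modulo
[N_n].  The subgroup of [G_(n+1)] fixing the first level contains [N_n x N_n],
and modulo it is generated by the two involutions [(a_s, a_r)] and [(a_r, a_s)];
it projects onto [G_n].  Hence, as soon as [G_n / N_n] is dihedral of order
exactly [2m],
  [|G_(n+1)| = 2 |G_n|^2 / (2m)].
For [n <= r] one has [G_n = Aut(T_n)].  For [n >= r] the signs of the actions on
the levels [s] and [r] separate [a_s] and [a_r] modulo [N_n], so [2m >= 4].
Explicit relations give [m <= 2] when [s >= 2] and [r >= 4], and [m <= 4] when
[s = 1 < 3 <= r] or [(s, r) = (2, 3)]; in the last two cases an explicit normal
subgroup avoiding [(a_s a_r)^2] shows [m = 4], except that [m = 2] for
[(s, r) = (2, 3)] and [n = 3].  When [(s, r) = (1, 2)] the group [G_n] itself is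
dihedral of order at most [2^(n+1)]. *)
Require Import Defs.
From HB Require Import structures.
From mathcomp Require Import all_boot all_order all_algebra all_fingroup.
From mathcomp Require Import cyclic zify.

Set Implicit Arguments.
Unset Strict Implicit.
Unset Printing Implicit Defensive.

Section FiniteLevels.
Import GroupScope.
Local Open Scope group_scope.

(** * Order bounds for groups generated by two involutions modulo a normal subgroup *)

Section FiniteGroupCounting.
Variable gT : finGroupType.
Implicit Types (x y : gT) (G H N : {group gT}).

Lemma expg2_eq1_inv x : x ^+ 2 = 1 -> x^-1 = x.
Proof. by rewrite expgS expg1 => xx; apply/eqP; rewrite eq_invg_mul xx. Qed.

(** Conjugation by the involution x inverts x y, so <x> normalizes <x y> and the whole group lies in
    <x y><x>. *)
Lemma card_dihedral_le x y m : 0 < m ->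
  x ^+ 2 = 1 -> y ^+ 2 = 1 -> (x * y) ^+ m = 1 ->
  #|<<[set x; y]>>| <= 2 * m.
Proof.
move=> m_gt0 x2 y2 xym.
have xV := expg2_eq1_inv x2; have yV := expg2_eq1_inv y2.
have xnorm : <[x]> \subset 'N(<[x * y]>).
  have xyJ : (x * y) ^ x = (x * y)^-1.
    by rewrite conjgE -mulgA mulKg invMg xV yV.
  by rewrite norms_cycle xyJ groupV cycle_id.
have sub : <<[set x; y]>> \subset <[x * y]> <*> <[x]>.
  rewrite gen_subG subUset !sub1set.
  have xH : x \in <[x * y]> <*> <[x]>.
    by rewrite (subsetP (joing_subr _ _)) ?cycle_id.
  have xyH : x * y \in <[x * y]> <*> <[x]>.
    by rewrite (subsetP (joing_subl _ _)) ?cycle_id.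
  by rewrite xH -(groupMl y xH).
apply: leq_trans (subset_leq_card sub) _.
rewrite norm_joinEr //; apply: leq_trans (_ : #|<[x * y]>| * #|<[x]>| <= _).
  by rewrite mul_cardG leq_pmulr // cardG_gt0.
rewrite mulnC leq_mul // dvdn_leq // order_dvdn; exact/eqP.
Qed.

End FiniteGroupCounting.

Section FiniteGroupExtension.
Variable gT : finGroupType.
Implicit Types (x y : gT) (G H N : {group gT}).

Lemma card_joing_dihedral_le N x y m : 0 < m ->
  x \in 'N(N) -> y \in 'N(N) ->
  x ^+ 2 \in N -> y ^+ 2 \in N -> (x * y) ^+ m \in N ->
  #|N <*> <<[set x; y]>>| <= 2 * m * #|N|.
Proof.
move=> m_gt0 nx ny x2 y2 xym.
have nxy : [set x; y] \subset 'N(N) by rewrite subUset !sub1set nx.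
have nH : <<[set x; y]>> \subset 'N(N) by rewrite gen_subG.
have nNH : N <*> <<[set x; y]>> \subset 'N(N) by rewrite join_subG normG.
rewrite -(Lagrange (joing_subl N <<[set x; y]>>)) mulnC leq_pmul2r ?cardG_gt0 //.
rewrite -card_quotient //= quotientYidl // quotient_gen //.
rewrite /quotient morphimU !morphim_set1 //.
by apply: card_dihedral_le; rewrite // -?morphM -?morphX ?groupM //=;
  apply: coset_id.
Qed.

Lemma ltn_card_subgroup N H x :
  N \subset H -> x \in H -> x \notin N -> 2 * #|N| <= #|H|.
Proof.
move=> sNH xH xN; rewrite -(Lagrange sNH) mulnC leq_pmul2l ?cardG_gt0 //.
rewrite indexg_gt1; apply: contra xN => /subsetP; exact.
Qed.

End FiniteGroupExtension.

(* [(u, v, e)] encodes [(u, v) * sigma ^+ e]. *)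
Definition wreath (gT : Type) : Type := (gT * gT * bool)%type.

(** * The wreath product of a group with the group of order 2 *)

Section Wreath.
Variable gT : finGroupType.

HB.instance Definition _ := Finite.on (wreath gT).

Implicit Types x y : wreath gT.

Definition wr_one : wreath gT := (1, 1, false).

(** Moving [sigma] past a pair exchanges its components, whence the crossed products when [x.2]
    holds. *)
Definition wr_mul x y : wreath gT :=
  if x.2 then (x.1.1 * y.1.2, x.1.2 * y.1.1, ~~ y.2)
  else (x.1.1 * y.1.1, x.1.2 * y.1.2, y.2).

Definition wr_inv x : wreath gT :=
  if x.2 then (x.1.2^-1, x.1.1^-1, true) else (x.1.1^-1, x.1.2^-1, false).

Lemma wr_mulA : associative wr_mul.
Proof.
by move=> [[u v] []] [[u' v'] []] [[u'' v''] []]; rewrite /wr_mul /= ?mulgA.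
Qed.

Lemma wr_mul1 : left_id wr_one wr_mul.
Proof. by move=> [[u v] e]; rewrite /wr_mul /= !mul1g. Qed.

Lemma wr_mulV : left_inverse wr_one wr_inv wr_mul.
Proof. by move=> [[u v] []]; rewrite /wr_mul /wr_inv /= !mulVg. Qed.

HB.instance Definition _ :=
  Finite_isGroup.Build (wreath gT) wr_mulA wr_mul1 wr_mulV.

Lemma wrM x y : x * y = wr_mul x y. Proof. by []. Qed.
Lemma wrV x : x^-1 = wr_inv x. Proof. by []. Qed.
Lemma wr1 : 1 = wr_one. Proof. by []. Qed.

Definition wr_pair (u v : gT) : wreath gT := (u, v, false).
Definition wr_swap : wreath gT := (1, 1, true).

Lemma wr_pairM u v u' v' :
  wr_pair u v * wr_pair u' v' = wr_pair (u * u') (v * v').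
Proof. by []. Qed.

Lemma wr_pairX u v m : wr_pair u v ^+ m = wr_pair (u ^+ m) (v ^+ m).
Proof. by elim: m => // m IHm; rewrite !expgS IHm. Qed.

Lemma wr_pair_square u v w : v ^+ 2 = 1 ->
  (wr_pair u 1 * wr_pair w v) ^+ 2 = wr_pair ((u * w) ^+ 2) 1.
Proof. by rewrite wr_pairM wr_pairX mul1g => ->. Qed.

Lemma wr_pairV u v : (wr_pair u v)^-1 = wr_pair u^-1 v^-1.
Proof. by []. Qed.

Lemma wr_pairJ u v u' v' :
  wr_pair u v ^ wr_pair u' v' = wr_pair (u ^ u') (v ^ v').
Proof. by []. Qed.

Lemma wr_pair_swapJ u v : wr_pair u v ^ wr_swap = wr_pair v u.
Proof.
by rewrite conjgE !wrM wrV /wr_mul /= !invg1 !mul1g !mulg1.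
Qed.

Lemma wr_swap2 : wr_swap ^+ 2 = 1.
Proof. by rewrite expgS expg1 wrM /wr_mul /= !mulg1. Qed.

Lemma wr_swap_comm u : wr_swap * wr_swap ^ wr_pair u 1 = wr_pair u u^-1.
Proof. by rewrite conjgE wr_pairV !wrM /wr_mul /= ?invg1 ?mul1g ?mulg1. Qed.

Lemma wrE x : x = wr_pair x.1.1 x.1.2 * wr_swap ^+ x.2.
Proof. by case: x => [[u v] []]; rewrite /= ?expg0 ?expg1 wrM /wr_mul /= !mulg1. Qed.

End Wreath.

(** * Recursive models of the groups Aut(T_n), and the signs of their actions on levels *)

Fixpoint treeG (n : nat) : finGroupType :=
  if n is m.+1 then wreath (treeG m) else 'I_1.

Lemma card_treeG n : #|{: treeG n}| = (2 ^ (2 ^ n - 1))%N.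
Proof.
elim: n => [|n IHn]; first by rewrite card_ord.
have -> : #|{: treeG n.+1}| = #|{: treeG n * treeG n * bool}| by [].
rewrite !card_prod IHn card_bool -!expnD -expnSr; congr (_ ^ _)%N.
have := expn_gt0 2 n; rewrite expnS; lia.
Qed.

(* Levels are counted from 0: [sgn x m] is the sign of the action of [x] on the
   words of length [m.+1]. *)
Fixpoint sgn n : treeG n -> nat -> bool :=
  match n with
  | 0 => fun _ _ => false
  | n.+1 => fun x m =>
    if m is m.+1 then sgn x.1.1 m (+) sgn x.1.2 m else x.2
  end.

Lemma sgnM n (x y : treeG n) m : sgn (x * y) m = sgn x m (+) sgn y m.
Proof.
elim: n x y m => [//|n IHn] [[u v] e] [[u' v'] e'] [|m] /=.
  by case: e.
by rewrite wrM /wr_mul; case: e => /=;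
  rewrite !IHn addbACA // [sgn v' m (+) _]addbC.
Qed.

Lemma sgn1 n m : sgn (1 : treeG n) m = false.
Proof. by have := sgnM (1 : treeG n) 1 m; rewrite mulg1 addbb. Qed.

Lemma sgnV n (x : treeG n) m : sgn x^-1 m = sgn x m.
Proof.
by have := sgnM x^-1 x m; rewrite mulVg sgn1; case: (sgn x m); case: (sgn _ m).
Qed.

Lemma sgnJ n (x y : treeG n) m : sgn (x ^ y) m = sgn x m.
Proof. by rewrite conjgE !sgnM sgnV addbCA addbb addbF. Qed.

Definition sgn_ker_set n m : {set treeG n} := [set x | ~~ sgn x m].

Lemma sgn_ker_group_set n m : group_set (sgn_ker_set n m).
Proof.
apply/group_setP; split=> [|x y]; rewrite !inE ?sgn1 // sgnM.
by move=> /negbTE-> /negbTE->.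
Qed.

Definition sgn_ker n m : {group treeG n} := Group (sgn_ker_group_set n m).

Lemma sgn_ker_norm n m (A : {set treeG n}) : A \subset 'N(sgn_ker n m).
Proof.
apply/subsetP=> x _; rewrite inE; apply/subsetP=> _ /imsetP[y + ->].
by rewrite !inE sgnJ.
Qed.

(** * The groups G_n and N_n *)

Section LevelGroups.
Variables r s : nat.
Hypotheses (s_gt0 : 0 < s) (s_lt_r : s < r).

(* The image of [a_i] in [Aut(T_n)]; only [1 <= i <= r] is meaningful. *)
Fixpoint alpha n : nat -> treeG n :=
  match n with
  | 0 => fun _ => 1
  | n.+1 => fun i =>
    if i == 1%N then wr_swap (treeG n)
    else if i == s.+1 then wr_pair (alpha n s) (alpha n r)
    else wr_pair (alpha n i.-1) 1
  end.

Lemma alphaS1 n : alpha n.+1 1 = wr_swap (treeG n). Proof. by []. Qed.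

Lemma alphaSs n : alpha n.+1 s.+1 = wr_pair (alpha n s) (alpha n r).
Proof. by rewrite /= eqxx eqSS eqn0Ngt s_gt0. Qed.

Lemma alphaSS n i : 0 < i -> i != s -> alpha n.+1 i.+1 = wr_pair (alpha n i) 1.
Proof. by case: i => // i _ /negbTE /= is'; rewrite !eqSS is'. Qed.

Lemma alpha_expg2 n i : alpha n i ^+ 2 = 1.
Proof.
elim: n i => [|n IHn] i /=; first by rewrite expg1n.
case: ifP => _; first exact: wr_swap2.
by case: ifP => _; rewrite wr_pairX !IHn ?expg1n.
Qed.

Lemma alphaV n i : (alpha n i)^-1 = alpha n i.
Proof. exact/expg2_eq1_inv/alpha_expg2. Qed.

Lemma alpha_eq1 n i : n < i -> alpha n i = 1.
Proof.
elim: n i => [|n IHn] i //= ni; case: ifP => [/eqP i1|_]; first by lia.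
case: ifP => [/eqP is'|_]; last by rewrite IHn //; lia.
by rewrite !IHn //; lia.
Qed.

(** In the inductive step for a_(s+1) = (a_s, a_r), the sign at [m.+1] is the sum of the signs of
    a_s and a_r at [m]; the bound [m.+1 < r] makes the second one vanish. *)
Lemma sgn_alpha n i m : 0 < i <= r -> m < n -> m < r ->
  sgn (alpha n i) m = (i == m.+1).
Proof.
elim: n i m => [//|n IHn] i m ir mn mr /=.
case: eqP => [->|i1].
  by case: m mn mr => [|m] mn mr //=; rewrite !sgn1.
case: eqP => [->|is']; case: m mn mr => [|m] mn mr /=.
- by apply/esym/negbTE; rewrite eqSS; lia.
- rewrite !IHn ?s_gt0 //=; try lia.
- by lia.
- by rewrite !IHn ?sgn1 ?addbF; lia.
Qed.

Definition Glev n : {group treeG n} := <<[set:: map (alpha n) (iota 1 r)]>>%G.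

Lemma alpha_Glev n i : 0 < i <= r -> alpha n i \in Glev n.
Proof.
by move=> ir; rewrite mem_gen // inE; apply: map_f; rewrite mem_iota; lia.
Qed.

Lemma swap_Glev n : wr_swap (treeG n) \in Glev n.+1.
Proof. by apply: (@alpha_Glev n.+1 1); lia. Qed.

Lemma pair_sr_Glev n : wr_pair (alpha n s) (alpha n r) \in Glev n.+1.
Proof. by rewrite -alphaSs; apply: (@alpha_Glev n.+1); lia. Qed.

Lemma pair_l_Glev n i : 0 < i < r -> i != s -> wr_pair (alpha n i) 1 \in Glev n.+1.
Proof. by move=> ir ineqs; rewrite -alphaSS; first (apply: (@alpha_Glev n.+1)); lia. Qed.

Lemma pair_flip_Glev n u v :
  wr_pair u v \in Glev n.+1 -> wr_pair v u \in Glev n.+1.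
Proof. by move=> uvG; rewrite -wr_pair_swapJ groupJ ?swap_Glev. Qed.

Lemma Glev_sub n (H : {group treeG n}) :
  (forall i, 0 < i <= r -> alpha n i \in H) -> Glev n \subset H.
Proof.
move=> alH; rewrite gen_subG; apply/subsetP=> x; rewrite inE => /mapP[i].
by rewrite mem_iota => ir ->; apply: alH; lia.
Qed.

Definition Nlev_gens n : {set treeG n} :=
  [set:: map (alpha n) [seq j <- iota 1 r.-1 | j != s]].

Definition Nlev n : {group treeG n} := <<class_support (Nlev_gens n) (Glev n)>>%G.

Lemma alpha_Nlev n j : 0 < j < r -> j != s -> alpha n j \in Nlev n.
Proof.
move=> jr js; rewrite mem_gen // (subsetP (sub_class_support _ _)) // inE.
by apply: map_f; rewrite mem_filter js mem_iota; lia.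
Qed.

Lemma Nlev_min n (M : {group treeG n}) : Glev n \subset 'N(M) ->
  (forall j, 0 < j < r -> j != s -> alpha n j \in M) -> Nlev n \subset M.
Proof.
move=> nM alM; rewrite gen_subG class_support_sub_norm //.
apply/subsetP=> x; rewrite inE => /mapP[j]; rewrite mem_filter mem_iota.
by move=> /andP[js jr] ->; apply: alM; lia.
Qed.

Lemma Glev_norm_Nlev n : Glev n \subset 'N(Nlev n).
Proof. by rewrite norms_gen ?class_support_norm. Qed.

Lemma Nlev_sub_Glev n : Nlev n \subset Glev n.
Proof. by apply: Nlev_min => [|j jr _]; [exact: normG | apply: alpha_Glev; lia]. Qed.

Lemma Nlev_conj n x g : x \in Nlev n -> g \in Glev n -> x ^ g \in Nlev n.
Proof. by move=> xN gG; rewrite memJ_norm // (subsetP (Glev_norm_Nlev n)). Qed.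

(** Induction on n. For n < r the element a_r is trivial on T_n, so (a_s, a_r) becomes (a_s, 1);
    with the other (a_i, 1) it generates G_n x 1, and conjugation by [sigma] gives 1 x G_n. *)
Lemma Glev_full n : n <= r -> Glev n = [set: treeG n]%G.
Proof.
elim: n => [|n IHn] nr.
  apply/val_inj/setP=> x; rewrite inE; have -> : x = 1 by rewrite [x]ord1.
  exact: group1 (Glev 0).
have gL : group_set [set u | wr_pair u 1 \in Glev n.+1].
  apply/group_setP; split=> [|u v]; first by rewrite inE (group1 (Glev n.+1)).
  by rewrite !inE => uL vL; have := groupM uL vL; rewrite wr_pairM mulg1.
have uG u : wr_pair u 1 \in Glev n.+1.
  have: u \in Glev n by rewrite IHn ?inE // ltnW.
  have /subsetP/(_ u) : Glev n \subset Group gL; last by rewrite inE.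
  apply: Glev_sub => i ir; rewrite inE.
  have [->|ineqr] := eqVneq i r; first by rewrite alpha_eq1 // (group1 (Glev n.+1)).
  have [->|ineqs] := eqVneq i s.
    by have := pair_sr_Glev n; rewrite (@alpha_eq1 n r).
  by apply: pair_l_Glev => //; lia.
have vG v : wr_pair 1 v \in Glev n.+1 by apply: pair_flip_Glev.
apply/val_inj/setP=> x; rewrite inE; rewrite [x]wrE groupM ?groupX ?swap_Glev //.
by have := groupM (uG x.1.1) (vG x.1.2); rewrite wr_pairM mulg1 mul1g.
Qed.

(** * The recursion for the order of G_n *)

Section Step.
Variables (n m : nat).
Hypothesis m_gt0 : 0 < m.
Let gT := treeG n.

(** Every generator of G_n occurs as a left component: a_i with i < r in a_(i+1), and a_r after
    exchanging the components of a_(s+1). *)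
Lemma ex_pair_Glev u : u \in Glev n -> exists v, wr_pair u v \in Glev n.+1.
Proof.
pose L : {set gT} := [set u | [exists v, wr_pair u v \in Glev n.+1]].
have gL : group_set L.
  apply/group_setP; split=> [|u1 u2].
    by rewrite inE; apply/existsP; exists 1; apply: (group1 (Glev n.+1)).
  rewrite !inE => /existsP[v1 v1G] /existsP[v2 v2G]; apply/existsP.
  by exists (v1 * v2); rewrite -wr_pairM groupM.
move=> uG; apply/existsP; suff: u \in Group gL by rewrite inE.
apply: subsetP uG; apply: Glev_sub => i ir; rewrite inE; apply/existsP.
have [->|ineqs] := eqVneq i s.
  by exists (alpha n r); apply: pair_sr_Glev.
have [->|ineqr] := eqVneq i r;
  first by exists (alpha n s); apply/pair_flip_Glev/pair_sr_Glev.
by exists 1; apply: pair_l_Glev => //; lia.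
Qed.

(** The v with (1, v) in G_(n+1) form a subgroup containing the generators of N_n. It is normalized
    by G_n because each element of G_n is a component of some pair in G_(n+1). *)
Lemma pair1_Glev v : v \in Nlev n -> wr_pair 1 v \in Glev n.+1.
Proof.
have gM : group_set [set v | wr_pair 1 v \in Glev n.+1].
  apply/group_setP; split=> [|u1 u2]; first by rewrite inE (group1 (Glev n.+1)).
  by rewrite !inE => uL vL; have := groupM uL vL; rewrite wr_pairM mulg1.
move=> vN; suff: v \in Group gM by rewrite inE.
apply: subsetP vN; apply: Nlev_min => [|j jr js].
  apply/subsetP=> g /ex_pair_Glev[h ghG]; rewrite inE.
  apply/subsetP=> _ /imsetP[w + ->]; rewrite !inE => wG.
  have hgG := pair_flip_Glev ghG.
  by have := groupJ wG hgG; rewrite wr_pairJ conj1g.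
by rewrite inE; apply/pair_flip_Glev/pair_l_Glev.
Qed.

Lemma card_Glev_ge : 2 * (#|Glev n| * #|Nlev n|) <= #|Glev n.+1|.
Proof.
(* [w u] completes u to a pair in G_(n+1); the default 1 is never taken for u in G_n. Multiplying
   [w u] by N_n and the pair by powers of [sigma] yields distinct elements. *)
pose w u := odflt 1 [pick v | wr_pair u v \in Glev n.+1].
have wP u : u \in Glev n -> wr_pair u (w u) \in Glev n.+1.
  rewrite /w; case: pickP => //= noP /ex_pair_Glev[v].
  by rewrite noP.
pose A : {set gT * gT * bool} := setX (setX (Glev n) (Nlev n)) [set: bool].
have cardA : #|A| = (2 * (#|Glev n| * #|Nlev n|))%N.
  by rewrite !cardsX cardsT card_bool mulnC.
pose f (z : gT * gT * bool) : treeG n.+1 :=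
  (z.1.1, w z.1.1 * z.1.2, z.2).
rewrite -cardA -(card_in_imset (f := f)); last first.
  by move=> [[u v] e] [[u' v'] e'] _ _ [] /= <- /mulgI <- <-.
apply/subset_leq_card/subsetP=> _ /imsetP[[[u v] e] + ->].
rewrite !inE /= => /andP[/andP[uG vN] _]; rewrite [f _]wrE /=.
rewrite groupM ?groupX ?swap_Glev //.
by have := groupM (wP _ uG) (pair1_Glev vN); rewrite wr_pairM mulg1.
Qed.

(** With a = (a_s, a_r) and b = (a_r, a_s), the group G_(n+1) lies in (N_n x N_n) <a, b> <sigma>,
    where a and b are involutions and (a b)^m lies in N_n x N_n. *)
Lemma card_Glev_le : (alpha n s * alpha n r) ^+ m \in Nlev n ->
  #|Glev n.+1| <= 2 * (2 * m * #|Nlev n| ^ 2)%N.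
Proof.
move=> xym; set x := alpha n s in xym *; set y := alpha n r in xym *.
pose NNs : {set treeG n.+1} :=
  [set z | [&& z.1.1 \in Nlev n, z.1.2 \in Nlev n & ~~ z.2]].
have gNN : group_set NNs.
  apply/group_setP; split=> [|[[u v] e] [[u' v'] e']].
    by rewrite inE wr1 /= !group1.
  rewrite !inE /= wrM /wr_mul /=; case: e => /=; rewrite ?andbF //.
  by move=> /and3P[uN vN _] /and3P[uN' vN' ->]; rewrite !groupM.
pose NN : {group treeG n.+1} := Group gNN.
have cardNN : #|NN| = (#|Nlev n| ^ 2)%N.
  have -> : NN = setX (setX (Nlev n) (Nlev n)) [set false] :> {set gT * gT * bool}.
    by apply/setP=> [[[u v] []]]; rewrite !inE /= ?andbF ?andbT.
  by rewrite !cardsX cards1 muln1.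
have pairNN u v : (wr_pair u v \in NN) = (u \in Nlev n) && (v \in Nlev n).
  by rewrite inE andbT.
have memNN z : z \in NN -> exists u v, [/\ z = wr_pair u v, u \in Nlev n & v \in Nlev n].
  by case: z => [[u v] []]; rewrite inE /= ?andbF // => /and3P[? ? _]; exists u, v.
have swN : wr_swap gT \in 'N(NN).
  rewrite inE; apply/subsetP=> _ /imsetP[_ /memNN[u [v [-> uN vN]]] ->].
  by rewrite wr_pair_swapJ pairNN vN.
have pairN u v : u \in Glev n -> v \in Glev n -> wr_pair u v \in 'N(NN).
  move=> uG vG; rewrite inE; apply/subsetP=> _ /imsetP[_ /memNN[u' [v' [-> ? ?]]] ->].
  by rewrite wr_pairJ pairNN !Nlev_conj.
have xG : x \in Glev n by apply: alpha_Glev; lia.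
have yG : y \in Glev n by apply: alpha_Glev; lia.
set a := wr_pair x y; set b := wr_pair y x.
pose P := NN <*> <<[set a; b]>>.
have swP : <[wr_swap gT]> \subset 'N(P).
  rewrite cycle_subG -sub1set normsY ?sub1set // -?sub1set norms_gen //.
  rewrite sub1set inE; apply/subsetP=> _ /imsetP[z + ->].
  by rewrite !inE => /orP[]/eqP->; rewrite wr_pair_swapJ eqxx ?orbT.
have aP : a \in P.
  by rewrite (subsetP (joing_subr _ _)) // mem_gen // !inE eqxx.
have bP : b \in P.
  by rewrite (subsetP (joing_subr _ _)) // mem_gen // !inE eqxx orbT.
have : Glev n.+1 \subset P <*> <[wr_swap gT]>.
  apply: Glev_sub => [[//|[|i]] ir].
    by rewrite (subsetP (joing_subr _ _)) // alphaS1 cycle_id.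
  rewrite (subsetP (joing_subl _ _)) //.
  have [[->]|ineqs] := eqVneq i.+1 s; first by rewrite alphaSs.
  by rewrite alphaSS // (subsetP (joing_subl _ _)) //
    pairNN group1 andbT alpha_Nlev //; lia.
move/subset_leq_card/leq_trans; apply.
rewrite norm_joinEr // mulnC; apply: leq_trans (_ : #|P| * #|<[wr_swap gT]>| <= _).
  by rewrite mul_cardG leq_pmulr // cardG_gt0.
rewrite leq_mul //; last first.
  by rewrite dvdn_leq // order_dvdn wr_swap2.
rewrite -cardNN; apply: card_joing_dihedral_le; rewrite ?pairN //.
- by rewrite wr_pairX pairNN !alpha_expg2 group1.
- by rewrite wr_pairX pairNN !alpha_expg2 group1.
(* The second component (a_r a_s)^m is the inverse of (a_s a_r)^m. *)
rewrite wr_pairM wr_pairX pairNN xym /= -groupV -expgVn invMg.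
by rewrite !alphaV.
Qed.

(** The two bounds on |G_(n+1)| force |G_n| <= 2m |N_n|, so the second hypothesis is an equality,
    both bounds coincide, and |N_n| can be eliminated. *)
Lemma card_Glev_step : (alpha n s * alpha n r) ^+ m \in Nlev n ->
  2 * m * #|Nlev n| <= #|Glev n| -> (#|Glev n.+1| * (2 * m) = 2 * #|Glev n| ^ 2)%N.
Proof.
move=> /card_Glev_le le1 le2; have := card_Glev_ge; have := cardG_gt0 (Nlev n).
move: le1 le2; move: #|Glev n.+1| #|Glev n| #|Nlev n| => G' G N le1 le2 N0 le3.
have eqG : G = (2 * m * N)%N.
  apply/eqP; rewrite eqn_leq le2 andbT -(leq_pmul2r N0).
  by have := leq_trans le3 le1; rewrite leq_pmul2l // -mulnn mulnA.
have {le1 le3} -> : G' = (2 * (G * N))%N.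
  by apply/eqP; rewrite eqn_leq le3 andbT eqG -mulnA mulnn.
by rewrite -!mulnA -mulnn; congr (2 * (G * _))%N; rewrite eqG mulnC.
Qed.

End Step.

(** * The order of a_s a_r modulo N_n *)

Lemma Nlev_sgn_ker n : r <= n ->
  Nlev n \subset Glev n :&: sgn_ker n s.-1 :&: sgn_ker n r.-1.
Proof.
move=> rn; have sub i : 0 < i <= r -> i = s \/ i = r ->
    Nlev n \subset sgn_ker n i.-1.
  move=> ir isr; apply: Nlev_min => [|j jr js]; first exact: sgn_ker_norm.
  by rewrite inE sgn_alpha ?prednK; lia.
rewrite !subsetI Nlev_sub_Glev !sub; by [lia | left | right].
Qed.

(** a_s is odd on level s, while a_r is even on level s and odd on level r, so each kernel at least
    halves the order. The indices [s.-1] and [r.-1] stand for words of length s and r. *)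
Lemma card_Glev_sgn_ker n : r <= n ->
  4 * #|Glev n :&: sgn_ker n s.-1 :&: sgn_ker n r.-1| <= #|Glev n|.
Proof.
move=> rn; set A1 := Glev n :&: _; set A2 := A1 :&: _.
have le1 : 2 * #|A1| <= #|Glev n|.
  apply: (@ltn_card_subgroup _ _ _ (alpha n s)); rewrite ?subsetIl //.
    by apply: alpha_Glev; lia.
  by rewrite !inE sgn_alpha ?prednK ?eqxx ?andbF; lia.
have le2 : 2 * #|A2| <= #|A1|.
  apply: (@ltn_card_subgroup _ _ _ (alpha n r)); rewrite ?subsetIl //.
    by rewrite inE alpha_Glev ?inE ?sgn_alpha ?prednK; lia.
  by rewrite !inE [sgn _ r.-1]sgn_alpha ?prednK ?eqxx ?andbF; lia.
by lia.
Qed.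

Lemma card_Nlev_ge4 n : r <= n -> 2 * 2 * #|Nlev n| <= #|Glev n|.
Proof.
move=> rn; apply: leq_trans (card_Glev_sgn_ker rn).
by rewrite leq_pmul2l // subset_leq_card ?Nlev_sgn_ker.
Qed.

(** The square (a_s a_r)^2 lies in both sign kernels but not in N_n, which doubles the previous
    bound. *)
Lemma card_Nlev_ge8 n : r <= n -> (alpha n s * alpha n r) ^+ 2 \notin Nlev n ->
  2 * 4 * #|Nlev n| <= #|Glev n|.
Proof.
move=> rn srN; apply: leq_trans (card_Glev_sgn_ker rn).
rewrite [X in X <= _](_ : _ = 4 * (2 * #|Nlev n|))%N; last by lia.
rewrite leq_pmul2l //; apply: ltn_card_subgroup srN; first exact: Nlev_sgn_ker.
rewrite !inE expgS expg1 !sgnM !addbb /= andbT.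
by rewrite !groupM ?alpha_Glev //; lia.
Qed.

Section Square.
Hypothesis s_gt1 : 1 < s.

(* With [p = a_i], [sigma * sigma ^ (p, 1) = (p, p)] lies in [N], and so does its
   product with its conjugate under [(q, 1)]. *)
Lemma comm_Nlev n i q : 0 < i < r -> i != s -> q ^+ 2 = 1 ->
  wr_pair q 1 \in Glev n.+1 -> wr_pair ((alpha n i * q) ^+ 2) 1 \in Nlev n.+1.
Proof.
move=> ir ineqs q2 qG; set p := alpha n i.
have pV : p^-1 = p := alphaV n i; have qV := expg2_eq1_inv q2.
have swN : wr_swap (treeG n) \in Nlev n.+1 by apply: (@alpha_Nlev n.+1 1); lia.
have ppN : wr_pair p p \in Nlev n.+1.
  have := groupM swN (Nlev_conj swN (pair_l_Glev n ir ineqs)).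
  by rewrite wr_swap_comm pV.
have := groupM ppN (Nlev_conj ppN qG); rewrite wr_pairJ wr_pairM conjg1.
have -> : p * p ^ q = (p * q) ^+ 2 by rewrite expgS expg1 conjgE qV !mulgA.
by have -> : p * p = 1 by rewrite -{1}pV mulVg.
Qed.

Lemma alpha_s_left n : alpha n.+1 s = wr_pair (alpha n s.-1) 1.
Proof. by have := @alphaSS n s.-1; rewrite prednK //; apply; lia. Qed.

(** Since a_3 is trivial on T_2, on T_3 one has a_2 = (a_1, 1) and a_3 = (a_2, 1), and [comm_Nlev]
    applies with i = 1 and q = a_2. *)
Lemma alpha_sr_square_level3 n : s = 2 -> r = 3 -> n = 3 ->
  (alpha n s * alpha n r) ^+ 2 \in Nlev n.
Proof.
case: n => // n s2 r3 [n2]; have alr : alpha n.+1 r = wr_pair (alpha n s) 1.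
  have -> : alpha n.+1 r = alpha n.+1 s.+1 by congr (alpha _ _); lia.
  by rewrite alphaSs [alpha n r]alpha_eq1 //; lia.
have alrG : wr_pair (alpha n s) 1 \in Glev n.+1.
  by rewrite -alr; apply: (@alpha_Glev n.+1); lia.
have s1 : s.-1 = 1%N by lia.
have := @comm_Nlev n 1 (alpha n s) _ _ (alpha_expg2 _ _) alrG.
by rewrite alpha_s_left alr s1 wr_pair_square ?expg1n //; apply; lia.
Qed.

(** Here a_s = (a_(s-1), 1). If r differs from s + 1, then a_r = (a_(r-1), 1) and [comm_Nlev]
    applies with q = a_(r-1). If r = s + 1, the square is ((a_(s-1) a_s)^2, 1), and a substitute for
    q = a_s is needed, as [pair_l_Glev] does not cover (a_s, 1). *)
Lemma alpha_sr_square n : 3 < r -> r <= n -> (alpha n s * alpha n r) ^+ 2 \in Nlev n.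
Proof.
case: n => [|[|n]] r_gt3 rn; [by lia | by lia |].
have s1 : 0 < s.-1 < r by lia.
have s1s : s.-1 != s by lia.
rewrite alpha_s_left; have [rs|rs] := eqVneq r s.+1.
  have -> : alpha n.+2 r = @wr_pair (treeG n.+1) (alpha n.+1 s) (alpha n.+1 r).
    by rewrite -alphaSs rs.
  (* The substitute is the commutator h = (a_(s-1), a_(s-1)) of a_1 and a_s. As s >= 3, also a_(s-1)
     = (a_(s-2), 1), so the second component of a_(s-1) h disappears on squaring. *)
  pose h := alpha n.+1 1 * alpha n.+1 1 ^ alpha n.+1 s.
  have hE : h = wr_pair (alpha n s.-1) (alpha n s.-1).
    by rewrite /h alpha_s_left wr_swap_comm alphaV.
  have hG : wr_pair h 1 \in Glev n.+2.
    have a1G : wr_pair (alpha n.+1 1) 1 \in Glev n.+2 by apply: pair_l_Glev; lia.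
    have := groupM a1G (groupJ a1G (pair_sr_Glev n.+1)).
    by rewrite wr_pairJ wr_pairM conj1g mulg1.
  have h2 : h ^+ 2 = 1 by rewrite hE wr_pairX !alpha_expg2.
  have aE : alpha n.+1 s.-1 = wr_pair (alpha n s.-2) 1.
    by have := @alphaSS n s.-2; rewrite prednK; [apply|]; lia.
  rewrite (@wr_pair_square (treeG n.+1) _ _ _ (alpha_expg2 n.+1 r)).
  suff -> : (alpha n.+1 s.-1 * alpha n.+1 s) ^+ 2 = (alpha n.+1 s.-1 * h) ^+ 2.
    exact: (@comm_Nlev n.+1 s.-1 h).
  by rewrite alpha_s_left aE hE !wr_pair_square ?alpha_expg2 ?expg1n.
have alr : alpha n.+2 r = @wr_pair (treeG n.+1) (alpha n.+1 r.-1) 1.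
  by have := @alphaSS n.+1 r.-1; rewrite prednK; [apply|]; lia.
have := @comm_Nlev n.+1 s.-1 (alpha n.+1 r.-1) s1 s1s (alpha_expg2 n.+1 r.-1).
rewrite alr wr_pair_square ?expg1n //; apply.
by apply: pair_l_Glev; lia.
Qed.

End Square.

(** With a_1 = [sigma] and a_r = (a_(r-1), 1), the square is (p, p), where p = a_(r-1) is an
    involution that is odd on level r - 1. This sign defines a normal subgroup containing N_n but
    not (p, p). *)
Lemma alpha_sr_notin_s1 n : s = 1%N -> 2 < r -> r <= n ->
  (alpha n s * alpha n r) ^+ 4 = 1 /\ (alpha n s * alpha n r) ^+ 2 \notin Nlev n.
Proof.
case: n => [|n] s1 r_gt2 rn; first by lia.
have alr : alpha n.+1 r = wr_pair (alpha n r.-1) 1.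
  by have := @alphaSS n r.-1; rewrite prednK; [apply|]; lia.
set p := alpha n r.-1 in alr.
have sqE : (alpha n.+1 s * alpha n.+1 r) ^+ 2 = wr_pair p p.
  by rewrite s1 alphaS1 alr expgS expg1 !wrM /wr_mul /= !mulg1 !mul1g.
split.
  by rewrite -[4]/(2 * 2)%N expgM sqE wr_pairX alpha_expg2.
(* Elements of the base whose two components both have even sign on level
   [r - 1]. *)
pose M : {set treeG n.+1} :=
  [set z | [&& ~~ sgn z.1.1 r.-2, ~~ sgn z.1.2 r.-2 & ~~ z.2]].
have gM : group_set M.
  apply/group_setP; split=> [|[[u v] e] [[u' v'] e']].
    by rewrite inE wr1 /= !sgn1.
  rewrite !inE wrM /wr_mul; case: e; rewrite /= ?andbF // !sgnM.
  by move=> /and3P[/negbTE-> /negbTE-> _] /and3P[/negbTE-> /negbTE-> ->].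
have nM : Glev n.+1 \subset 'N(Group gM).
  apply/subsetP=> [[[u v] e] _]; rewrite inE.
  apply/subsetP=> _ /imsetP[[[u' v'] e'] + ->].
  rewrite conjgE !wrM wrV /wr_inv /wr_mul !inE.
  by case: e; case: e'; rewrite /= ?andbF // !sgnM !sgnV !andbT
    => /andP[/negbTE-> /negbTE->]; rewrite /= ?addbF !addbb.
have sNM : Nlev n.+1 \subset Group gM.
  apply: Nlev_min => // [[//|[|j]]] jr js; first by rewrite s1 in js.
  (* Both components of a_2 = (a_1, a_r) are even on level r - 1, because r > 2. *)
  have [j1|j1] := eqVneq j.+1 s.
    have -> : alpha n.+1 j.+2 = wr_pair (alpha n s) (alpha n r) by rewrite -alphaSs j1.
    by rewrite inE /= !sgn_alpha; lia.
  by rewrite alphaSS // inE /= !sgn1 !sgn_alpha; lia.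
rewrite sqE; apply/negP=> /(subsetP sNM).
by rewrite inE /= !sgn_alpha ?prednK; lia.
Qed.

Lemma alpha_sr_notin_s2 n : s = 2 -> r = 3 -> 3 < n ->
  (alpha n s * alpha n r) ^+ 2 \notin Nlev n.
Proof.
case: n => [|[|n]] // s2 r3 n_gt1.
(* [((p, q) sigma^i, (p', q') sigma^j) sigma^e] belongs to [M] when [i = j] and
   [chi] agrees on [p, q, p', q']; [(a_2 a_3)^2 = ((sigma, sigma), 1)] does not. *)
pose chi (u : treeG n) := sgn u 0 (+) sgn u 1.
have chiM u v : chi (u * v) = chi u (+) chi v by rewrite /chi !sgnM addbACA.
have chi1 : chi 1 = false by rewrite /chi !sgn1.
have chiV u : chi u^-1 = chi u by rewrite /chi !sgnV.
pose M : {set treeG n.+2} := [set z | [&& z.1.1.2 == z.1.2.2,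
  chi z.1.1.1.1 == chi z.1.1.1.2, chi z.1.1.1.1 == chi z.1.2.1.1 &
  chi z.1.1.1.1 == chi z.1.2.1.2]].
have gM : group_set M.
  apply/group_setP; split.
    by rewrite inE wr1 /= chi1 !eqxx.
  move=> [[[[p q] i] [[p' q'] i']] e] [[[[a b] j] [[a' b'] j']] f].
  rewrite !inE /= => /and4P[/eqP ii /eqP c1 /eqP c2 /eqP c3].
  move=> /and4P[/eqP jj /eqP d1 /eqP d2 /eqP d3]; subst i' j'.
  rewrite wrM /wr_mul; case: e => /=; rewrite !wrM /wr_mul; case: i => /=;
  by rewrite !chiM -?c1 -?c2 -?c3 -?d1 -?d2 -?d3 !eqxx.
(* Normality is needed only under the generators; equal sums of [chi] over the left and the right
   pair of components suffice for normalizing M. *)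
have normM (g : treeG n.+2) :
    chi g.1.1.1.1 (+) chi g.1.1.1.2 = chi g.1.2.1.1 (+) chi g.1.2.1.2 ->
    g \in 'N(Group gM).
  case: g => [[[[a b] j] [[a' b'] j']] f] /= gE; rewrite inE.
  apply/subsetP=> _ /imsetP[[[[[p q] i] [[p' q'] i']] e] + ->].
  rewrite !inE /= => /and4P[/eqP ii /eqP c1 /eqP c2 /eqP c3]; subst i'.
  move: gE; rewrite conjgE; case: f; case: e;
    rewrite !(wrM, wrV) /wr_mul /wr_inv /= !(wrM, wrV) /wr_mul /wr_inv;
    case: j; case: j'; case: i; rewrite /= !chiM !chiV -?c1 -?c2 -?c3;
    by case: (chi a); case: (chi b); case: (chi a'); case: (chi b');
       case: (chi p).
have al1 : alpha n.+1 s.-1 = wr_swap (treeG n) by have -> : s.-1 = 1%N by lia.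
have als : alpha n.+2 s = @wr_pair (treeG n.+1) (wr_swap (treeG n)) 1.
  by have := @alphaSS n.+1 s.-1; rewrite prednK // al1; apply; lia.
have als1 : alpha n.+1 s = @wr_pair (treeG n) (alpha n 1) 1.
  by have := @alphaSS n s.-1; rewrite prednK // s2; apply.
have alr : alpha n.+2 r = @wr_pair (treeG n.+1) (alpha n.+1 s) (alpha n.+1 r).
  by rewrite -alphaSs; congr (alpha _ _); lia.
have alr1 : alpha n.+1 r = @wr_pair (treeG n) (alpha n s) (alpha n r).
  by rewrite -alphaSs; congr (alpha _ _); lia.
have chial i : 0 < i <= r -> chi (alpha n i) = (i < 3).
  by move=> ir; rewrite /chi !sgn_alpha; lia.
have nM : Glev n.+2 \subset 'N(Group gM).
  apply: (@Glev_sub n.+2 'N(Group gM)%G) => i ir; apply: normM.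
  have [->|/eqP is_] := eqVneq i s; first by rewrite als /= chi1.
  (* The sums for a_3 = ((a_1, 1), (a_2, a_3)) agree, as [chi] is 1 on a_1 and a_2 and 0 on a_3. *)
  have [->|/eqP ir_] := eqVneq i r.
    by rewrite alr als1 alr1 /= !chial ?chi1; lia.
  by have -> : i = 1%N by [lia]; rewrite alphaS1 /= chi1.
have sNM : Nlev n.+2 \subset Group gM.
  apply: Nlev_min => // j jr js; have -> : j = 1%N by lia.
  by rewrite inE alphaS1 /= chi1 !eqxx.
apply/negP=> /(subsetP sNM).
rewrite als alr als1 alr1 expgS expg1 inE /= !mul1g !mulg1 => /and3P[_ + _].
by rewrite !chiM !chial //; lia.
Qed.

(** * Closed formulas for the order of G_n *)

Lemma card_Glev_eq n : n <= r -> #|Glev n| = (2 ^ (2 ^ n - 1))%N.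
Proof. by move=> nr; rewrite Glev_full // cardsT card_treeG. Qed.

(** This is the recursion for m = 2^c. It sends the exponent c + e to 2(c + e) + 1 - (c + 1) = c +
    2e, so e doubles at each level. *)
Lemma card_Glev_from n0 c A :
  (forall n, n0 <= n -> #|Glev n.+1| * 2 ^ c.+1 = 2 * #|Glev n| ^ 2)%N ->
  #|Glev n0| = (2 ^ (c + A))%N ->
  forall k, #|Glev (n0 + k)| = (2 ^ (c + A * 2 ^ k))%N.
Proof.
move=> step G0; elim=> [|k IHk]; first by rewrite addn0 muln1.
apply/eqP; rewrite -(eqn_pmul2r (expn_gt0 2 c.+1 : 0 < 2 ^ c.+1)) addnS.
rewrite step ?leq_addr // IHk -expnM -expnS -expnD; apply/eqP.
by congr (2 ^ _)%N; rewrite expnS; lia.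
Qed.

(** Since (a_1 a_2)^2 = (a_2 a_1, a_1 a_2), induction shows that the order of a_1 a_2 on T_n divides
    2^n. *)
Lemma card_Glev_s1r2 n : s = 1%N -> r = 2 -> #|Glev n| <= 2 * 2 ^ n.
Proof.
move=> s1 r2; have alsr : (alpha n s * alpha n r) ^+ (2 ^ n)%N = 1.
  elim: n => [|n IHn]; first by rewrite expg1 mulg1.
  have alr : alpha n.+1 r = wr_pair (alpha n s) (alpha n r).
    by rewrite -alphaSs; congr (alpha _ _); lia.
  have -> : alpha n.+1 s = wr_swap (treeG n) by rewrite s1.
  have sqE : (wr_swap (treeG n) * alpha n.+1 r) ^+ 2
           = wr_pair (alpha n r * alpha n s) (alpha n s * alpha n r).
    by rewrite alr expgS expg1 !wrM /wr_mul /= !mul1g.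
  rewrite expnS expgM sqE; apply: etrans (wr_pairX _ _ _) _.
  rewrite IHn -[(alpha n r * _) ^+ _]invgK -expgVn invMg !alphaV IHn.
  by rewrite invg1.
apply: leq_trans (card_dihedral_le _ (alpha_expg2 n s) (alpha_expg2 n r) alsr).
  apply/subset_leq_card/Glev_sub => i ir; rewrite mem_gen // !inE.
  by have [->|->] : i = s \/ i = r by [lia|]; rewrite eqxx ?orbT.
by rewrite expn_gt0.
Qed.

Lemma card_Glev_s1 k : s = 1%N -> 2 < r ->
  #|Glev (r + k)| = (2 ^ (2 + (2 ^ r - 3) * 2 ^ k))%N.
Proof.
move=> s1 r_gt2; apply: card_Glev_from => [n rn|].
  have [sr4 sr2] := alpha_sr_notin_s1 s1 r_gt2 rn.
  by apply: (card_Glev_step (m := 4)); rewrite ?sr4 ?group1 ?card_Nlev_ge8.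
rewrite card_Glev_eq //; congr (2 ^ _)%N.
by have := leq_pexp2l (isT : 0 < 2) r_gt2; lia.
Qed.

Lemma card_Glev_s2r3 k : s = 2 -> r = 3 ->
  #|Glev (4 + k)| = (2 ^ (2 + 11 * 2 ^ k))%N.
Proof.
move=> s2 r3; have s_gt1 : 1 < s by lia.
have a1s4 n : ((alpha n.+1 1 * alpha n.+1 s) ^+ 2) ^+ 2 = 1.
  have -> : (alpha n.+1 1 * alpha n.+1 s) ^+ 2 = wr_pair (alpha n s.-1) (alpha n s.-1).
    by rewrite alpha_s_left // alphaS1 expgS expg1 !wrM /wr_mul /= !mul1g !mulg1.
  by apply: etrans (wr_pairX _ _ _) _; rewrite alpha_expg2.
have alsr4 n : (alpha n.+2 s * alpha n.+2 r) ^+ 4 = 1.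
  have als : alpha n.+2 s = @wr_pair (treeG n.+1) (alpha n.+1 s.-1) 1.
    exact: alpha_s_left.
  have alr : alpha n.+2 r = @wr_pair (treeG n.+1) (alpha n.+1 s) (alpha n.+1 r).
    by rewrite -alphaSs; congr (alpha _ _); lia.
  rewrite -[4]/(2 * 2)%N expgM als alr.
  rewrite (@wr_pair_square (treeG n.+1)); last exact: (alpha_expg2 n.+1).
  have -> : s.-1 = 1%N by lia.
  by apply: etrans (wr_pairX _ _ _) _; rewrite a1s4 expg1n.
apply: card_Glev_from => [n n_gt3|].
  apply: (card_Glev_step (m := 4)) => //.
    by case: n n_gt3 => [|[|n]] // _; rewrite alsr4 group1.
  by apply: card_Nlev_ge8; [lia | apply: alpha_sr_notin_s2].
(* The passage from level 3 to level 4 has m = 2, so |G_4| = 2 (2^7)^2 / 4 = 2^13, and 13 = 2 + 11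
   starts the recursion with m = 4. *)
have step n : n = 3 -> (#|Glev n.+1| * 2 ^ 2 = 2 * #|Glev n| ^ 2)%N.
  move=> n3; apply: (card_Glev_step (m := 2)) => //.
    exact: alpha_sr_square_level3.
  by apply: card_Nlev_ge4; lia.
apply/eqP; rewrite -(eqn_pmul2r (expn_gt0 2 2 : 0 < 2 ^ 2)) step //.
by rewrite card_Glev_eq ?r3 // -expnM -expnS -expnD.
Qed.

Lemma card_Glev_generic k : 1 < s -> 3 < r ->
  #|Glev (r + k)| = (2 ^ (1 + (2 ^ r - 2) * 2 ^ k))%N.
Proof.
move=> s_gt1 r_gt3; apply: card_Glev_from => [n rn|].
  by apply: (card_Glev_step (m := 2)); rewrite ?alpha_sr_square ?card_Nlev_ge4.
rewrite card_Glev_eq //; congr (2 ^ _)%N.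
by have := leq_pexp2l (isT : 0 < 2) r_gt3; lia.
Qed.

End LevelGroups.

End FiniteLevels.

From mathcomp Require Import all_classical all_reals all_analysis.

(** * Sections of tree automorphisms and the homomorphisms from [W] to the recursive models *)

Section Sections.
Implicit Types (g h : W) (t : word) (b : bool).
Local Open Scope group_scope.

(* [g = Wpair (sec false g) (sec true g) * sigma ^+ top g]. *)
Definition top g : bool := head false (g [:: false]).

Lemma W_nil g : g [::] = [::]. Proof. by have [_ ->] := W_aut g. Qed.

Lemma W_inj g : injective g.
Proof. by have [/bij_inj ginj _ _] := W_aut g. Qed.

Lemma size_W g t : size (g t) = size t.
Proof. exact/size_tree_aut/W_aut. Qed.

Lemma head_W g b t : head false (g (b :: t)) = head false (g [:: b]).
Proof.
elim/last_ind: t => // t c; rewrite -rcons_cons.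
have : child (b :: t) (rcons (b :: t) c) by apply/existsP; exists c.
move=> /(tree_aut_child (W_aut g))/existsP[d /eqP->].
by have := size_W g (b :: t); case: (g (b :: t)).
Qed.

(** The first letter of an image depends only on the first letter of the word, and the two words of
    length 1 are permuted. *)
Lemma W_cons g b t : g (b :: t) = b (+) top g :: behead (g (b :: t)).
Proof.
have -> : b (+) top g = head false (g (b :: t)).
  rewrite head_W /top.
  case: b => //=; have := size_W g [:: true]; have := size_W g [:: false].
  have := @W_inj g [:: true] [:: false].
  case: (g [:: true]) => [//|c [|//]]; case: (g [:: false]) => [//|d [|//]].
  by case: c; case: d => //= /(_ erefl).
by have := size_W g (b :: t); case: (g (b :: t)).
Qed.

Lemma topM g h : top (g * h) = top g (+) top h.
Proof.
rewrite {1}/top /= W_cons /=.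
by rewrite W_cons /=.
Qed.

Lemma top1 : top 1 = false. Proof. by []. Qed.

Lemma W_mulVE g t : (g^-1 * g) t = t.
Proof. by rewrite mulVg. Qed.

Lemma W_mulgVE g t : (g * g^-1) t = t.
Proof. by rewrite mulgV. Qed.

Lemma is_tree_aut_sec b g : is_tree_aut (fun t => behead (g (b :: t))).
Proof.
split; last 2 first.
- by have := size_W g [:: b]; case: (g [:: b]) => [//|c []].
- move=> x y; have [_ _ gA] := W_aut g; have := gA (b :: x) (b :: y).
  by rewrite (W_cons g b x) (W_cons g b y) !adj_cons !eqxx.
have topV : top g^-1 = top g.
  by have := topM g^-1 g; rewrite mulVg top1; case: top; case: top.
exists (fun t => behead (g^-1 (b (+) top g :: t))) => t.
  by rewrite -W_cons -[g^-1 _]/((g * g^-1) _) W_mulgVE.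
have := W_cons g^-1 (b (+) top g) t; rewrite topV addbK => {1}<-.
by rewrite -[g _]/((g^-1 * g) _) W_mulVE.
Qed.

Definition sec b g : W := mkW (is_tree_aut_sec b g).

Lemma secM b g h : sec b (g * h) = sec b g * sec (b (+) top g) h.
Proof. by apply: WP => t /=; rewrite {1}W_cons. Qed.

Fixpoint rho n : W -> treeG n :=
  match n with
  | 0 => fun _ => 1
  | n.+1 => fun g => (rho n (sec false g), rho n (sec true g), top g)
  end.

Lemma rhoM n g h : rho n (g * h) = rho n g * rho n h.
Proof.
elim: n g h => [|n IHn] g h /=; first by rewrite mulg1.
by rewrite wrM /wr_mul /= !secM !IHn topM; case: (top g).
Qed.

Lemma rho1 n : rho n 1 = 1.
Proof. by apply: (mulgI (rho n 1)); rewrite -rhoM !mulg1. Qed.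

Lemma rhoV n g : rho n g^-1 = (rho n g)^-1.
Proof. by apply: (mulgI (rho n g)); rewrite -rhoM !mulgV rho1. Qed.

Lemma rho_pair n u v : rho n.+1 (Wpair u v) = wr_pair (rho n u) (rho n v).
Proof. by congr (rho n _, rho n _, _); apply: WP. Qed.

Lemma rho_sigma n : rho n.+1 sigma = wr_swap (treeG n).
Proof.
by rewrite /wr_swap -!(rho1 n); congr (rho n _, rho n _, _); apply: WP.
Qed.

Lemma rho_surj n (x : treeG n) : exists g, rho n g = x.
Proof.
elim: n x => [|n IHn] x; first by exists 1; rewrite [LHS]ord1 [RHS]ord1.
have [u uE] := IHn x.1.1; have [v vE] := IHn x.1.2.
rewrite [x]wrE -uE -vE; case: x.2.
  by exists (Wpair u v * sigma); rewrite rhoM rho_pair rho_sigma expg1.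
by exists (Wpair u v); rewrite rho_pair expg0 mulg1.
Qed.

Lemma rho_eqP n g h :
  rho n g = rho n h <-> (forall t, size t <= n -> g t = h t).
Proof.
elim: n g h => [|n IHn] g h /=.
  by split=> // _ [|//] _; rewrite !W_nil.
split=> [[/IHn eF /IHn eT et] [|b t] tn|gh]; first by rewrite !W_nil.
  by rewrite (W_cons g) (W_cons h) et;
    congr cons; case: b tn => tn; [apply: eT | apply: eF].
rewrite /top gh //; congr (_, _, _); apply/IHn => t tn /=; rewrite gh //.
Qed.

Lemma restr_rho n g h : restr n g = restr n h <-> rho n g = rho n h.
Proof.
rewrite rho_eqP; split=> [/permP gh t tn|gh].
  by have := gh (Bseq tn); rewrite !permE => /(congr1 val).
by apply/permP=> x; rewrite !permE; apply/val_inj/gh/size_bseq.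
Qed.

End Sections.

(** * The automorphism group of T_n and its order *)

Section FiniteTree.
Variable n : nat.
Local Notation X := (n.-bseq bool).
Implicit Types (p : {perm X}) (x y : X) (t u : word).
Local Open Scope group_scope.

Lemma WnP p :
  reflect (p [bseq] = [bseq] /\ forall x y, adj (p x) (p y) = adj x y)
          (p \in Wn n).
Proof.
rewrite inE; apply: (iffP andP) => [[/eqP p0 /forallP pA]|[-> pA]].
  by split=> // x y; apply/eqP/(forallP (pA x)).
by split=> //; apply/forallP=> x; apply/forallP=> y; rewrite pA.
Qed.

Lemma Wn_inv p : p \in Wn n -> p^-1 \in Wn n.
Proof.
move=> /WnP[p0 pA]; apply/WnP; split; first by rewrite -[in LHS]p0 permK.
by move=> x y; rewrite -[LHS]pA !permKV.
Qed.

Lemma Wn_child p x y : p \in Wn n -> child x y -> child (p x) (p y).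
Proof.
move=> /WnP[p0 pA]; case: x => x xn; elim/last_ind: x xn y => [|x c IHx] xn y xy.
  have x0 : Bseq xn = [bseq] by apply: val_inj.
  have := pA [bseq] y; rewrite -x0 {2}/adj xy x0 p0 /adj /=.
  by rewrite child_nil0 orbF.
have xn' : size x <= n by have := xn; rewrite size_rcons; apply: ltnW.
have xxc : child (Bseq xn') (Bseq xn) by apply/existsP; exists c.
have := pA (Bseq xn) y; rewrite {2}/adj xy /= => /orP[//|yx].
have := child_inj yx (IHx xn' _ xxc) => /val_inj/perm_inj yE.
by move/size_child: xy; rewrite yE /= size_rcons; lia.
Qed.

Lemma size_Wn p x : p \in Wn n -> size (p x) = size x.
Proof.
move=> pW; case: x => x xn; elim/last_ind: x xn => [|x c IHx] xn.
  by have /WnP[p0 _] := pW; have -> : Bseq xn = [bseq] by [apply: val_inj]; rewrite p0.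
have xn' : size x <= n by have := xn; rewrite size_rcons; apply: ltnW.
have xxc : child (Bseq xn') (Bseq xn) by apply/existsP; exists c.
by rewrite (size_child (Wn_child pW xxc)) IHx /= size_rcons.
Qed.

Lemma size_take_bseq t : size (take n t) <= n.
Proof. by rewrite size_take; case: ltnP => // /leqW. Qed.

(* Extends [p] to the whole tree by copying the letters beyond level [n]. *)
Definition ext p t : word := p (Bseq (size_take_bseq t)) ++ drop n t.

Lemma ext_bseq p x : ext p x = p x.
Proof.
rewrite /ext drop_oversize ?size_bseq // cats0; congr (val (p _)).
by apply: val_inj; rewrite /= take_oversize ?size_bseq.
Qed.

Lemma extK p : p \in Wn n -> cancel (ext p) (ext p^-1).
Proof.
move=> pW t; have sp := size_Wn (Bseq (size_take_bseq t)) pW.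
have [nt|tn] := leqP n (size t).
  have sn : size (p (Bseq (size_take_bseq t))) = n.
    by rewrite sp /= size_takel.
  rewrite {1}/ext drop_size_cat // -[RHS](cat_take_drop n); congr (_ ++ _).
  rewrite (_ : Bseq _ = p (Bseq (size_take_bseq t))) ?permK //.
  by apply: val_inj; rewrite /= take_size_cat.
have tE : t = Bseq (ltnW tn) by [].
by rewrite tE ext_bseq ext_bseq permK.
Qed.

Lemma ext_child p t u : p \in Wn n -> child t u -> child (ext p t) (ext p u).
Proof.
move=> pW tu; have su := size_child tu.
have [un|nu] := leqP (size u) n.
  have tn : size t <= n by rewrite ltnW // -su.
  have := @Wn_child p (Bseq tn) (Bseq un) pW tu.
  by rewrite -!ext_bseq.
have nt : n <= size t by rewrite -ltnS -su.
move: tu => /existsP[b /eqP uE]; apply/existsP; exists b.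
rewrite /ext uE drop_rcons // -rcons_cat; apply/eqP; congr (rcons (val (p _) ++ _) b).
by apply: val_inj; rewrite /= -cats1 takel_cat.
Qed.

Lemma ext_adj p t u : p \in Wn n -> adj t u -> adj (ext p t) (ext p u).
Proof. by move=> pW /orP[] /(ext_child pW) tu; rewrite /adj tu ?orbT. Qed.

Lemma ext_tree_aut p : p \in Wn n -> is_tree_aut (ext p).
Proof.
move=> pW; have pVW := Wn_inv pW; have pK := extK pW.
have pVK : cancel (ext p^-1) (ext p) by have := extK pVW; rewrite invgK.
split; first by exists (ext p^-1).
  by have /WnP[p0 _] := pW; have := ext_bseq p [bseq]; rewrite p0.
move=> t u; apply/idP/idP; last exact: ext_adj.
by move/(ext_adj pVW); rewrite !pK.
Qed.

Lemma restr_surj p : p \in Wn n -> exists g, restr n g = p.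
Proof.
move=> pW; exists (mkW (ext_tree_aut pW)); apply/permP=> x.
by apply: val_inj; rewrite permE /= ext_bseq.
Qed.

(** A lift to [W] is chosen and restricted to T_n; by [restr_rho] the result does not depend on the
    lift. *)
Definition tree_perm (x : treeG n) : {perm X} := restr n (sval (cid (rho_surj x))).

Lemma restrE g : restr n g = tree_perm (rho n g).
Proof. by rewrite /tree_perm; case: cid => h /= /restr_rho ->. Qed.

Lemma tree_perm_inj : injective tree_perm.
Proof.
move=> x y; have [g <-] := rho_surj x; have [h <-] := rho_surj y.
by rewrite -!restrE => /restr_rho.
Qed.

Lemma card_Wn : #|Wn n| = (2 ^ (2 ^ n - 1))%N.
Proof.
rewrite -card_treeG -cardsT -(card_imset _ tree_perm_inj); apply: eq_card => p.
apply/idP/imsetP => [/restr_surj[g <-]|[x _ ->]]; last exact: restr_Wn.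
by exists (rho n g); rewrite ?inE // restrE.
Qed.

End FiniteTree.

(** * The finite images of the topologically generated group *)

Section Generated.
Local Open Scope classical_set_scope.
Local Open Scope group_scope.
Variables (r s : nat) (a : nat -> W).
Hypotheses (s_gt0 : 0 < s) (s_lt_r : s < r).
Hypothesis (a1 : a 1%N = sigma).
Hypothesis (as1 : a s.+1 = Wpair (a s) (a r)).
Hypothesis (ai : forall i : nat, 0 < i <= r -> i <> 1%N -> i <> s.+1 ->
  a i = Wpair (a i.-1) 1).

Lemma rho_alpha n i : 0 < i <= r -> rho n (a i) = alpha r s n i.
Proof.
elim: n i => [//|n IHn] i ir.
have [->|/eqP i1] := eqVneq i 1%N; first by rewrite a1 rho_sigma.
have [->|/eqP is1] := eqVneq i s.+1.
  by rewrite as1 rho_pair !IHn ?alphaSs //; lia.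
rewrite ai // rho_pair rho1 IHn; last by lia.
have [i0 iE] : 0 < i.-1 /\ i = i.-1.+1 by lia.
by rewrite [in RHS]iE alphaSS //; lia.
Qed.

Definition generators : set W := [set a i | i in [set i : nat | 0 < i <= r]].

Lemma restr_nbhs n g : nbhs g [set h | restr n h = restr n g].
Proof.
have cont : continuous (fun h : W =>
    restr_all h n : discrete_topology {perm n.-bseq bool}).
  move=> h; apply: (@continuous_comp _ _ _ restr_all
    (fun f => f n)); first exact: initial_continuous.
  exact: proj_continuous.
have := cont g [set restr n g]; apply.
by rewrite nbhs_principalE; apply/principal_filterP.
Qed.

Lemma smallest_subgroup : subgroup (smallest subgroup generators).
Proof.
split=> [H [[H1 _] _] //|g h gH hH H [sH SH]].
by case: (sH) => _; apply; [apply: gH | apply: hH].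
Qed.

(** The closure adds nothing on T_n: the automorphisms agreeing with g there form a neighbourhood of
    g, which meets the abstract subgroup when g lies in its closure. *)
Lemma rho_topgen n (x : treeG n) :
  (exists2 g, topgen generators g & rho n g = x) <-> x \in Glev r s n.
Proof.
split=> [[g gG <-]|].
  have [h [hH gh]] := gG _ (restr_nbhs n g).
  move/restr_rho: gh <-; apply: (hH [set h | rho n h \in Glev r s n]); split.
    split=> [/=|g1 g2 /= g1G g2G]; first by rewrite rho1 group1.
    by rewrite rhoM rhoV groupM ?groupV.
  by move=> _ [i ir <-] /=; rewrite rho_alpha // alpha_Glev.
have gL : group_set [set x : treeG n | `[< exists2 g,
    smallest subgroup generators g & rho n g = x >]]%SET.
  have [H1 HM] := smallest_subgroup.
  have HV g : smallest subgroup generators g -> smallest subgroup generators g^-1.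
    by move=> gH; rewrite -[g^-1]mul1g; apply: HM.
  apply/group_setP; split=> [|y z].
    by rewrite !inE; exists 1; rewrite ?rho1.
  rewrite !inE => -[g gH <-] [h hH <-]; exists (g * h); rewrite ?rhoM //.
  by rewrite -[h]invgK; apply: HM => //; apply: HV.
move=> xG; have : x \in Group gL.
  apply: (fintype.subsetP _ _ xG); apply: (Glev_sub s_gt0 s_lt_r) => i ir; rewrite !inE.
  exists (a i); last by rewrite rho_alpha.
  by move=> H [_]; apply; exists i.
rewrite !inE => -[g gH gx]; exists g => //.
exact: subset_closure.
Qed.

Lemma card_Gn n : #|Gn (topgen generators) n| = #|Glev r s n|.
Proof.
rewrite -(card_imset _ (@tree_perm_inj n)); apply: eq_card => p.
rewrite inE; apply/idP/imsetP => [|[x xG ->]].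
  rewrite inE => -[g gG <-]; exists (rho n g); last exact: restrE.
  by apply/rho_topgen; exists g.
rewrite inE; have [g gG <-] := (rho_topgen x).2 xG.
by exists g => //; rewrite restrE.
Qed.

End Generated.

(** * Limits of the quotients of logarithms *)

Section HausdorffDimension.
Import Order.TTheory GRing.Theory Num.Theory.
Import numFieldNormedType.Exports.
Local Open Scope classical_set_scope.
Local Open Scope ring_scope.
Variable R : realType.

Lemma log2_exp2 m : log2 (2 ^ m)%N%:R = m%:R :> R.
Proof.
rewrite /log2 natrX lnXn ?ltr0n // -[ln _ *+ m]mulr_natl mulfK // gt_eqF //.
by rewrite ln_gt0 // ltr1n.
Qed.

Lemma log2_card_Wn n : log2 #|Wn n|%:R = 2 ^+ n - 1 :> R.
Proof. by rewrite card_Wn log2_exp2 natrB ?expn_gt0 // natrX. Qed.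

(** Dividing numerator and denominator by 2^k turns the quotient into (c 2^-k + A) / (2^n0 -
    2^-k). *)
Lemma has_Hausdorff_dim_exp2 (G : set W) n0 c A :
  (forall k, #|Gn G (n0 + k)| = (2 ^ (c + A * 2 ^ k))%N) ->
  has_Hausdorff_dim G (A%:R / 2 ^+ n0 : R).
Proof.
move=> cardG; rewrite /has_Hausdorff_dim -(cvg_shiftn n0) /=.
have q0 : (2^-1 : R) ^+ k @[k --> \oo] --> (0 : R).
  by apply: cvg_expr; rewrite ger0_norm ?invr_ge0 // invf_lt1 // ltr1n.
have uE k : log2 #|Gn G (k + n0)|%:R / log2 #|Wn (k + n0)|%:R
    = (c%:R * 2^-1 ^+ k + A%:R) / (2 ^+ n0 - 2^-1 ^+ k) :> R.
  rewrite log2_card_Wn addnC cardG log2_exp2 natrD natrM natrX exprD.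
  have k0 : 2 ^+ k != 0 :> R by rewrite expf_neq0.
  rewrite exprVn; set u := c%:R / _ + _; set v := _ - _^-1.
  have -> : u / v = (u * 2 ^+ k) / (v * 2 ^+ k) by rewrite -mulf_div divff ?mulr1.
  by rewrite [u * _]mulrDl divfK // [v * _]mulrBl mulVf.
rewrite (eq_cvg _ _ uE).
have -> : A%:R / 2 ^+ n0 = (c%:R * 0 + A%:R) / (2 ^+ n0 - 0) :> R.
  by rewrite mulr0 add0r subr0.
apply: cvgM.
  by apply: cvgD; [apply: cvgMr | apply: cvg_cst].
apply: cvgV; first by rewrite subr0 expf_neq0.
by apply: cvgB => //; apply: cvg_cst.
Qed.

(** For n >= 1 this says (n + 1) / (2^n - 1) <= 4 / (n + 1), the upper bound in the squeeze
    below. *)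
Lemma leq_sqr_exp2 n : ((n.+1 ^ 2 + 4 <= 4 * 2 ^ n)%N || (n == 0)%N).
Proof.
elim: n => // -[|n] IHn //; rewrite orbF in IHn *.
by rewrite -mulnn (expnS 2 n.+1) in IHn *; nia.
Qed.

Lemma has_Hausdorff_dim0 (G : set W) :
  (forall n, 0 < #|Gn G n| <= 2 * 2 ^ n)%N -> has_Hausdorff_dim G (0 : R).
Proof.
move=> cardG; rewrite /has_Hausdorff_dim.
have h0 : 4 * (@harmonic R) n @[n --> \oo] --> (0 : R).
  by rewrite -[X in _ --> X](mulr0 4); apply: cvgMr; apply: cvg_harmonic.
apply: (squeeze_cvgr _ (cvg_cst 0) h0); near=> n.
have /andP[G0 G2] := cardG n; have n0 : (0 < n)%N by near: n; exists 1%N.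
have ln2 : 0 < ln 2 :> R by rewrite ln_gt0 // ltr1n.
have Wgt0 : 0 < 2 ^+ n - 1 :> R.
  by rewrite subr_gt0 exprn_egt1 ?ltr1n // -lt0n.
have lnG : log2 #|Gn G n|%:R <= n.+1%:R :> R.
  rewrite -[leRHS]log2_exp2 expnS /log2 ler_pM2r ?invr_gt0 // ler_ln ?ler_nat //.
    by rewrite posrE ltr0n.
  by rewrite posrE ltr0n -expnS expn_gt0.
have lnG0 : 0 <= log2 #|Gn G n|%:R :> R.
  by rewrite /log2 divr_ge0 ?(ltW ln2) // ln_ge0 // ler1n.
rewrite log2_card_Wn divr_ge0 ?(ltW Wgt0) //= ler_pdivrMr //.
apply: le_trans lnG _.
rewrite /harmonic mulrAC ler_pdivlMr ?ltr0Sn //.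
have := leq_sqr_exp2 n; rewrite [n == 0%N]gtn_eqF // orbF -(ler_nat R).
rewrite natrD natrM !natrX expr2 => nn.
by rewrite mulrBr mulr1 lerBrDr.
Unshelve. all: by end_near.
Qed.

End HausdorffDimension.

Unset Implicit Arguments.

Import Order.TTheory GRing.Theory Num.Theory.
Local Open Scope classical_set_scope.
Local Open Scope ring_scope.

Theorem theorem3p3p4 (R : realType) (r s : nat) (a : nat -> W)
    (hs : (1 <= s)%N) (hsr : (s < r)%N)
    (ha1 : a 1%N = sigma)
    (has1 : a s.+1 = Wpair (a s) (a r))
    (hai : forall i : nat, (1 <= i <= r)%N -> i <> 1%N -> i <> s.+1 ->
       a i = Wpair (a i.-1) 1%g) :
  let G := topgen [set a i | i in [set i : nat | (1 <= i <= r)%N]] in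
  [/\ s = 1%N /\ r = 2%N -> has_Hausdorff_dim G (0 : R),
      s = 1%N /\ (3 <= r)%N -> has_Hausdorff_dim G (1 - 3 * 2 ^- r : R),
      s = 2%N /\ r = 3%N -> has_Hausdorff_dim G (1 - 5 * 2 ^- 4 : R)
    & (2 <= s)%N /\ (4 <= r)%N ->
        has_Hausdorff_dim G (1 - 2 ^ (1 - r%:Z) : R)].
Proof.
move=> G; have cardG n : #|Gn G n| = #|Glev r s n| by exact: card_Gn.
have two_neq0 : (2 : R) != 0 by rewrite pnatr_eq0.
have pow2_neq0 m : (2 : R) ^+ m != 0 by rewrite expf_neq0.
(* Here d is the defect 2^r - A of the constant A in the order formula: 3 for s = 1 and r >= 3, and
   2 for s >= 2 and r >= 4. *)
have dimE d : (d <= 2 ^ r)%N -> (2 ^ r - d)%N%:R / 2 ^+ r = 1 - d%:R * 2 ^- r :> R.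
  by move=> dr; rewrite natrB // natrX mulrBl divff.
have pow2_ge m : (m <= r)%N -> (2 ^ m <= 2 ^ r)%N by apply: leq_pexp2l.
split=> [[s1 r2]|[s1 r3]|[s2 r3]|[s2 r4]].
- apply: has_Hausdorff_dim0 => n; rewrite cardG fingroup.cardG_gt0.
  exact: card_Glev_s1r2.
- rewrite -dimE; last by have := pow2_ge _ r3; apply: leq_trans.
  by apply: has_Hausdorff_dim_exp2 => k; rewrite cardG; apply: card_Glev_s1.
- have -> : 1 - 5 * 2 ^- 4 = 11%:R / 2 ^+ 4 :> R.
    rewrite -[X in X - _](divff (pow2_neq0 4)) -mulrBl; congr (_ / _).
    by rewrite -natrX -natrB.
  by apply: has_Hausdorff_dim_exp2 => k; rewrite cardG; apply: card_Glev_s2r3.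
have -> : 1 - 2 ^ (1 - r%:Z) = (2 ^ r - 2)%N%:R / 2 ^+ r :> R.
  rewrite dimE; last by have := pow2_ge _ r4; apply: leq_trans.
  by rewrite expfzDr // expr1z exprnN.
by apply: has_Hausdorff_dim_exp2 => k; rewrite cardG; apply: card_Glev_generic.
Qed.
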